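(* Let $p,r\ge 0$ be integers with $p\le r+1$, let $a_1,\dots,a_{r+1}$ be complex numbers satisfying $a_i-a_j\notin\mathbb{Z}$ for $1\le i<j\le r+1$, let $b_1,\dots,b_p$ be complex numbers, and let $m_1,\dots,m_p$ be integers such that, whenever $m_j<0$, $a_i-b_j\notin\{0,1,\dots,-m_j-1\}$ for all $1\le i\le r+1$. Put $M:=\sum_{i=1}^p m_i$, $$c_i:=\frac{\prod_{j=1}^p(1+a_i-b_j)_{m_j}}{\prod_{1\le j\le r+1,\ j\ne i}(a_i-a_j)}\qquad(1\le i\le r+1),$$ and $$H(z):=\sum_{i=1}^{r+1}c_i\times{}_pF_r\Big(\begin{matrix}1+a_i+m_1-b_1,\dots,1+a_i+m_p-b_p\\ 1+a_i-a_1,\dots,*,\dots,1+a_i-a_{r+1}\end{matrix}\Big|\,z\Big)\times{}_pF_r\Big(\begin{matrix}b_1-a_i,\dots,b_p-a_i\\ 1+a_1-a_i,\dots,*,\dots,1+a_{r+1}-a_i\end{matrix}\Big|\,(-1)^{p+r+1}z\Big),$$ where the asterisk means that the term $1+a_i-a_i$ is omitted (so each lower parameter list has $r$ entries, indexed by $j\neq i$). Assume first that $m_i\ge 0$ for all $1\le i\le p$. Then: (i) If $M<r$, then $H(z)\equiv 0$. (ii) If $M=r$, then $H(z)\equiv 1$ in the case $p\le r$, and $H(z)\equiv 1/(1-z)$ in the case $p=r+1$. (iii) If $M=r+1$, then $H(z)\equiv C$ in the case $p\le r-1$; $H(z)\equiv C+z$ in the case $p=r$; and $$H(z)\equiv(\alpha-\beta+p)\frac{z}{(1-z)^2}+\frac{C}{1-z}\quad\text{in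 the case }p=r+1,$$ where $\alpha=\sum_{i=1}^{r+1}a_i$, $\beta=\sum_{i=1}^p b_i$ and $C=\alpha+\sum_{i=1}^p m_i(m_i+1-2b_i)/2$. In the case when some of the $m_i$ are negative, the results in (i)-(iii) (with the same hypotheses on $M$ and $p$ and the same right-hand sides) hold modulo $\mathcal{P}_{-\hat m}$, where $\hat m=\min_{1\le i\le p}m_i$.
   Context: The Pochhammer symbol is $(a)_k:=\Gamma(a+k)/\Gamma(a)$ for $k\in\mathbb{Z}$, understood as $(a)_k=\prod_{s=0}^{k-1}(a+s)$ for $k\ge 0$ and $(a)_{-n}=1/\prod_{s=1}^{n}(a-s)$ for $n\ge 1$. The hypergeometric function is $${}_pF_r\Big(\begin{matrix}b_1,\dots,b_p\\ a_1,\dots,a_r\end{matrix}\Big|\,z\Big):=\sum_{k\ge 0}\frac{(b_1)_k\cdots(b_p)_k}{(a_1)_k\cdots(a_r)_k}\cdot\frac{z^k}{k!}.$$ For $p<r+1$ it is an entire function of $z$; for $p=r+1$ the series converges for $|z|<1$. Empty products equal $1$ and empty sums equal $0$. For functions represented by power series in $z$, $F(z)\equiv G(z)$ means that $F(z)=G(z)$ for all $z$ in some neighbourhood of zero. $\mathcal{P}_n$ denotes the set of polynomials in $z$ of degree at most $n$, and $F(z)\equiv G(z)$ modulo $\mathcal{P}_n$ means that $F(z)-G(z)\in\mathcal{P}_n$ (as functions in a neighbourhood of zero). *)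

(* Defs.v *)
From HB Require Import structures.
From mathcomp Require Export all_boot all_order all_algebra.
From mathcomp Require Export complex.
From mathcomp Require Export all_classical all_reals all_analysis.
Export Order.TTheory GRing.Theory Num.Theory numFieldNormedType.Exports.

Set Implicit Arguments.
Unset Strict Implicit.
Unset Printing Implicit Defensive.

Local Open Scope classical_set_scope.
Local Open Scope ring_scope.

(* [Negz n] is the integer - n.+1. *)
Definition poch (K : fieldType) (x : K) (k : int) : K :=
  match k with
  | Posz n => \prod_(0 <= s < n) (x + s%:R)
  | Negz n => (\prod_(1 <= s < n.+2) (x - s%:R))^-1
  end.

(* [limn] is a total function: this is the value of the hypergeometric series
   wherever the series converges (a neighbourhood of 0 when p <= r + 1 and
   no a j is a non-positive integer) and a default value elsewhere. *)
Definition hypergeom (K : numFieldType) (p r : nat)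
    (b : 'I_p -> K) (a : 'I_r -> K) (z : K) : K :=
  limn (series (fun k : nat =>
    (\prod_(j < p) poch (b j) k) / (\prod_(j < r) poch (a j) k)
      * (z ^+ k / (k`!)%:R))).

Definition eq_near0 (K : numFieldType) (F G : K -> K) : Prop :=
  \forall z \near (0 : K), F z = G z.

(* [size q <= n.+1] means that q has degree at most n. *)
Definition eq_near0_mod (K : numFieldType) (n : nat) (F G : K -> K) : Prop :=
  exists2 q : {poly K}, (size q <= n.+1)%N &
    \forall z \near (0 : K), F z - G z = q.[z].

Section SumOfProducts.
Variables (K : numFieldType) (p r : nat).
Variables (a : 'I_r.+1 -> K) (b : 'I_p -> K) (m : 'I_p -> int).

Definition coefc (i : 'I_r.+1) : K :=
  (\prod_(j < p) poch (1 + a i - b j) (m j))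
    / \prod_(j < r.+1 | j != i) (a i - a j).

(* As j ranges over 'I_r, [lift i j] ranges over the indices distinct from i. *)
Definition sumH (z : K) : K :=
  \sum_(i < r.+1) coefc i
    * hypergeom (fun j : 'I_p => 1 + a i + (m j)%:~R - b j)
        (fun j : 'I_r => 1 + a i - a (lift i j)) z
    * hypergeom (fun j : 'I_p => b j - a i)
        (fun j : 'I_r => 1 + a (lift i j) - a i) ((-1) ^+ (p + r + 1) * z).

End SumOfProducts.

(* Main.v *)
Require Import Defs.
From mathcomp Require Import ring zify.

(** The coefficient of [z ^ n] in [H] is a sum over [i] and over [k + l = n],
    where [k] and [l] index the terms of the two series attached to [i].  With
    [t = a_i + k], all the Pochhammer symbols of such a term regroup into the
    value at [t] of
      [N(t) = \prod_j \prod_(s < m_j + n) (t - (b_j + n - 1 - s))]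
    divided by [\prod (t - t')] over the other points [t'] of the grid
    [{a_j + s : j <= r, s <= n}] ([term_residue]).  So the coefficient is the
    sum of the residues of [N / D], where [D] vanishes simply at the
    [(r + 1) * (n + 1)] points of the grid; the noncongruence of the [a_i]
    makes these points distinct.  By Lagrange interpolation this sum is [0] if
    [deg N < deg D - 1], is [1] if [deg N = deg D - 1], and is the sum of the
    roots of [D] minus the sum of the roots of [N] if [deg N = deg D]
    ([sum_residues]).  Since [deg N = M + p * n] as soon as every [m_j + n] is
    nonnegative, comparing degrees gives the coefficients ([sumH_coefE]), and
    they are those of the right-hand sides.  The indices [n] with [m_j + n < 0]
    for some [j] are not covered, and account for the polynomial modulo which
    the identities hold when some [m_j] is negative.

    What remains is to pass from formal series to functions.  The
    coefficients of each hypergeometric series grow at most geometrically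
    ([hgcoef_growth]), so near zero the two factors of every summand are
    dominated by a geometric series of ratio [1 / 8], for which the Cauchy
    product converges to the product of the sums ([cvg_cauchy_product]).
    Hence [H] is near zero the sum of the series of its coefficients
    ([cvg_sumH]). *)

Set Implicit Arguments.
Unset Strict Implicit.
Unset Printing Implicit Defensive.

Local Open Scope classical_set_scope.
Local Open Scope ring_scope.

(** * Sums of residues at simple poles *)

(** Both sides are the coefficient of top degree in the Lagrange interpolation
    formula for [N] at the nodes [x i]. *)
Lemma sum_horner_over_nodes (F : fieldType) (I : finType) (x : I -> F)
    (N : {poly F}) :
  injective x -> (size N <= #|I|)%N ->
  \sum_i N.[x i] / \prod_(j | j != i) (x i - x j) = N`_#|I|.-1.
Proof.
move=> xI sN.
pose L i := \prod_(j | j != i) ('X - (x j)%:P).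
have Lx i : (L i).[x i] = \prod_(j | j != i) (x i - x j).
  by rewrite horner_prod; apply: eq_bigr => j _; rewrite !hornerE.
have Lxx i : \prod_(j | j != i) (x i - x j) != 0.
  apply/prodf_neq0 => j ji; rewrite subr_eq0; apply: contra ji.
  by move=> /eqP/xI ->.
have L0 i k : k != i -> (L i).[x k] = 0.
  by move=> ki; rewrite horner_prod (bigD1 k) //= !hornerE subrr mul0r.
have sL i : size (L i) = #|I|.
  have -> : L i = \prod_(j <- enum (predC1 i)) ('X - (x j)%:P).
    by rewrite big_enum.
  rewrite size_prod_XsubC -cardE cardC1 prednK //.
  by apply/card_gt0P; exists i.
have mL i : (L i)`_#|I|.-1 = 1.
  by rewrite -(sL i); apply/eqP/monic_prod_XsubC.
have NE : N = \sum_i (N.[x i] / \prod_(j | j != i) (x i - x j)) *: L i.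
  apply/eqP; rewrite -subr_eq0; apply/eqP.
  apply: (@roots_geq_poly_eq0 _ _ [seq x i | i <- enum I]).
  - apply/allP => _ /mapP [i _ ->].
    rewrite rootE !hornerE horner_sum (bigD1 i) //= [X in _ - (_ + X)]big1 => [|k ki].
      by rewrite hornerZ Lx divfK // addr0 subrr.
    by rewrite hornerZ L0 ?mulr0 // eq_sym.
  - by rewrite map_inj_uniq // enum_uniq.
  - rewrite size_map -cardE (leq_trans (size_polyD _ _)) // geq_max sN.
    rewrite size_polyN (leq_trans (size_sum _ _ _)) //.
    by apply/bigmax_leqP => i _; rewrite (leq_trans (size_scale_leq _ _)) ?sL.
rewrite {2}NE coef_sum; apply: eq_bigr => i _.
by rewrite coefZ mL mulr1.
Qed.

(** The sum of the residues of [N / D], with [N] and [D] monic and split.  In the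
    case of equal degrees, [N] may be replaced by [N - D], which takes the same
    values at the nodes and whose coefficient of degree [#|I|.-1] is the
    difference of the sums of roots. *)
Lemma sum_residues (F : fieldType) (I : finType) (x : I -> F) (s : seq F) :
  injective x -> (size s <= #|I|)%N ->
  \sum_i (\prod_(u <- s) (x i - u)) / \prod_(j | j != i) (x i - x j)
  = if size s == #|I| then \sum_i x i - \sum_(u <- s) u
    else (size s == #|I|.-1)%:R.
Proof.
move=> xI; pose N := \prod_(u <- s) ('X - u%:P).
have NE t : \prod_(u <- s) (t - u) = N.[t].
  by rewrite horner_prod; apply: eq_bigr => j _; rewrite !hornerE.
have sN : size N = (size s).+1 by rewrite size_prod_XsubC.
have mN : N`_(size s) = 1.
  by have /monicP := monic_prod_XsubC s xpredT id; rewrite /lead_coef sN.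
under eq_bigr do rewrite NE.
rewrite leq_eqVlt; case: eqP => [es _ | _ /= ls]; last first.
  rewrite sum_horner_over_nodes ?sN //.
  case: eqP => [<- // | /eqP ns]; rewrite nth_default // sN.
  by move: ns ls; move: (size s) #|I| => u d; lia.
have [s0|s0] := posnP (size s).
  move/eqP: (s0); rewrite {1}es => /eqP c0.
  have noI (i : I) : false by have := card0_eq c0 i; rewrite inE.
  rewrite [LHS]big1 => [|i]; last by have := noI i.
  by rewrite (size0nil s0) big_nil [\sum_i _]big1 ?subrr // => i; have := noI i.
pose D := \prod_i ('X - (x i)%:P).
have DE : D = \prod_(u <- [seq x i | i <- enum I]) ('X - u%:P).
  by rewrite big_map big_enum.
have sx : size [seq x i | i <- enum I] = #|I| by rewrite size_map -cardE.
have sD : size D = #|I|.+1 by rewrite DE size_prod_XsubC sx.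
have D0 i : D.[x i] = 0.
  by rewrite horner_prod (bigD1 i) //= !hornerE subrr mul0r.
have mD : D`_#|I| = 1.
  have /monicP : D \is monic by apply: monic_prod_XsubC.
  by rewrite /lead_coef sD.
under eq_bigr => i _ do rewrite -[N.[_]]subr0 -(D0 i) -hornerN -hornerD.
rewrite sum_horner_over_nodes //; last first.
  apply/leq_sizeP => j; rewrite leq_eqVlt => /predU1P [<-|lj].
    by rewrite coefB mD -es mN subrr.
  by rewrite coefB !nth_default ?subrr // ?sN ?sD // es.
rewrite coefB -{1}es coefPn_prod_XsubC -?lt0n // DE -sx.
by rewrite coefPn_prod_XsubC ?sx -?es -?lt0n // big_map big_enum /= opprK addrC.
Qed.

(** * Pochhammer symbols with integer index *)

Section Pochhammer.
Variable K : fieldType.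
Implicit Types (x y : K) (m k l q n : nat).

Lemma poch_nat x n : poch x n = \prod_(0 <= s < n) (x + s%:R).
Proof. by []. Qed.

Lemma poch0 x : poch x 0 = 1.
Proof. exact: big_geq. Qed.

Lemma poch_natD x m n : poch x (m + n)%N = poch x m * poch (x + m%:R) n.
Proof.
rewrite !poch_nat (@big_cat_nat _ _ _ m) ?leq_addr //=; congr (_ * _).
rewrite -{1}[m]add0n big_addn addKn; apply: eq_bigr => s _.
by rewrite natrD addrAC addrA.
Qed.

Lemma prod_sub_nat x n :
  \prod_(0 <= s < n) (x - s%:R) = poch (x - n%:R + 1) n.
Proof.
rewrite poch_nat big_nat_rev /=; apply: eq_big_nat => s /andP[_ sn].
by rewrite add0n natrB // -natr1; ring.
Qed.

Lemma poch_opp x n : poch (- x) n = (- 1) ^+ n * poch (x - n%:R + 1) n.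
Proof.
rewrite -prod_sub_nat poch_nat -{2}[n]subn0 -prodr_const_nat -big_split /=.
by apply: eq_bigr => s _; ring.
Qed.

Lemma poch_neg x q :
  poch (1 + x) (- q%:Z) = (\prod_(0 <= s < q) (x - s%:R))^-1.
Proof.
case: q => [|q]; first by rewrite oppr0 poch0 big_geq ?invr1.
rewrite -NegzE /= big_add1 /=; congr (_^-1).
by apply: eq_bigr => s _; rewrite -natr1; ring.
Qed.

(** The three symbols are products of factors [x + u] over intervals of integers
    [u], which join into the single interval from [1 - l] to [m + k].  For
    negative [m] the factors of the denominator have to cancel, so they must
    not vanish. *)
Lemma poch_product x (m : int) k l q :
  m + (k + l)%N%:Z = q%:Z ->
  (m < 0 -> forall s : nat, (s < `|m|)%N -> x != s%:R) ->
  poch (1 + x) m * poch (1 + x + m%:~R) k * poch (- x) l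
  = (- 1) ^+ l * poch (x - l%:R + 1) q.
Proof.
rewrite poch_opp; case: (intP m) => [|m'|d] {m} mq xm.
- have -> : q = (l + k)%N by lia.
  rewrite poch_natD poch0 !addr0.
  have -> : x - l%:R + 1 + l%:R = 1 + x by ring.
  ring.
- have -> : q = (l + (m'.+1 + k))%N by lia.
  rewrite !poch_natD.
  have -> : x - l%:R + 1 + l%:R = 1 + x by ring.
  rewrite -pmulrn; ring.
- set e := d.+1 in mq xm *.
  have rE : \prod_(0 <= s < e) (x - s%:R) != 0.
    rewrite prodf_seq_neq0; apply/allP => s; rewrite mem_index_iota => /andP[_ se].
    by rewrite subr_eq0 xm // abszN.
  rewrite poch_neg; move: rE; rewrite prod_sub_nat => rE.
  rewrite rmorphN /= -pmulrn -mulrA.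
  suff key : poch (1 + x - e%:R) k * poch (x - l%:R + 1) l =
      poch (x - e%:R + 1) e * poch (x - l%:R + 1) q.
    by rewrite [poch _ k * _]mulrCA key mulrCA mulKf.
  have [ek|ke] := leqP e k.
    have -> : k = (e + (k - e))%N by lia.
    have -> : q = (l + (k - e))%N by lia.
    rewrite !poch_natD.
    have -> : x - l%:R + 1 + l%:R = 1 + x by ring.
    have -> : 1 + x - e%:R + e%:R = 1 + x by ring.
    have -> : 1 + x - e%:R = x - e%:R + 1 by ring.
    ring.
  have -> : e = (k + (e - k))%N by lia.
  rewrite [poch _ (k + (e - k))%N]poch_natD.
  have -> : l = (q + (e - k))%N by lia.
  rewrite [poch _ (q + (e - k))%N]poch_natD.
  have -> : (k + (e - k))%N = e by lia.
  have -> : (x - (q + (e - k))%:R + 1 + q%:R) = 1 + x - e%:R + k%:R.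
    by rewrite natrD natrB 1?ltnW //; ring.
  have -> : 1 + x - e%:R = x - e%:R + 1 by ring.
  ring.
Qed.

(** Here [y = a i - a j], and the left-hand side collects the differences between
    [a i + k] and the points [a j + s] of another column of the grid. *)
Lemma prod_pole_other y k l :
  \prod_(0 <= s < (k + l).+1) (y + k%:R - s%:R)
  = y * poch (1 + y) k * ((- 1) ^+ l * poch (1 - y) l).
Proof.
rewrite prod_sub_nat.
have -> : y + k%:R - (k + l).+1%:R + 1 = y - l%:R by rewrite -natr1 natrD; ring.
have -> : (k + l).+1 = (l + (1 + k))%N by lia.
rewrite !poch_natD [poch _ 1]poch_nat big_nat1.
have -> : y - l%:R + l%:R = y by ring.
have -> : 1 - y = - (y - 1) by ring.
rewrite poch_opp [_ ^+ l * _]mulrA -exprMn mulrNN mulr1 expr1n mul1r.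
have -> : y - 1 - l%:R + 1 = y - l%:R by ring.
have -> : y + 1 = 1 + y by ring.
by rewrite addr0; ring.
Qed.

(** The differences between [a i + k] and the other points of its own column. *)
Lemma prod_pole_same n (k : 'I_n.+1) :
  \prod_(s < n.+1 | s != k) (k%:R - s%:R : K)
  = k`!%:R * ((- 1) ^+ (n - k) * (n - k)`!%:R).
Proof.
have fE m : m`!%:R = \prod_(0 <= s < m) (s.+1%:R : K).
  by rewrite fact_prod natr_prod big_add1.
(* Replacing the factor of index k by 1 allows splitting the range at k. *)
rewrite (big_mkcond (fun s => s != k)) /=.
rewrite -(big_mkord xpredT (fun s : nat => if s != k then k%:R - s%:R else 1 : K)).
have kn := ltn_ord k.
rewrite (@big_cat_nat _ _ _ k) //=; last exact: ltnW.
rewrite (big_ltn kn) eqxx mul1r !fE; congr (_ * _).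
  rewrite big_nat_rev /=; apply: eq_big_nat => s /andP[_ sk].
  rewrite add0n ifT; last lia.
  by rewrite -natrB; [congr (_%:R)|]; lia.
rewrite -{1}[k.+1]add0n big_addn subSS.
rewrite -{2}[(n - k)%N]subn0 -prodr_const_nat -big_split /=.
apply: eq_big_nat => s _; rewrite ifT; last lia.
by rewrite addnS -addSn natrD; ring.
Qed.

End Pochhammer.

(** * The power series coefficients of H *)

Lemma prod_lift (K : comNzRingType) r (i : 'I_r.+1) (f : 'I_r.+1 -> K) :
  \prod_(j < r) f (lift i j) = \prod_(j | j != i) f j.
Proof.
rewrite [RHS]big_mkcond (bigD1_ord i) //= eqxx mul1r.
by apply: eq_bigr => j _; rewrite eq_sym neq_lift.
Qed.

Lemma sum_nat_half (K : numFieldType) n :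
  \sum_(0 <= s < n) s%:R = n%:R * (n%:R - 1) / 2 :> K.
Proof.
elim: n => [|n IHn]; first by rewrite big_geq // !mul0r.
by rewrite big_nat_recr //= IHn -natr1; field.
Qed.

Section Coefficients.
Variables (K : numFieldType) (p r : nat).

Definition hgcoef r' (b : 'I_p -> K) (a : 'I_r' -> K) (k : nat) : K :=
  (\prod_(j < p) poch (b j) k) / (\prod_(j < r') poch (a j) k) / k`!%:R.

Variables (a : 'I_r.+1 -> K) (b : 'I_p -> K) (m : 'I_p -> int).

Definition left_coef i : nat -> K :=
  hgcoef (fun j : 'I_p => 1 + a i + (m j)%:~R - b j)
         (fun j : 'I_r => 1 + a i - a (lift i j)).

(** The sign comes from the argument [(-1) ^+ (p + r + 1) * z] of the second
    factor. *)
Definition right_coef i (l : nat) : K :=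
  ((-1) ^+ (p + r + 1)) ^+ l *
  hgcoef (fun j : 'I_p => b j - a i) (fun j : 'I_r => 1 + a (lift i j) - a i) l.

Definition sumH_coef (n : nat) : K :=
  \sum_(i < r.+1) coefc a b m i *
    \sum_(k < n.+1) left_coef i k * right_coef i (n - k).

Hypothesis ha : forall i j : 'I_r.+1, (i < j)%N ->
  forall k : int, a i - a j <> k%:~R.
Hypothesis hb : forall j : 'I_p, m j < 0 -> forall (i : 'I_r.+1) (k : int),
  0 <= k <= - m j - 1 -> a i - b j <> k%:~R.

Lemma a_not_congruent (i j : 'I_r.+1) (k : int) :
  i != j -> a i - a j <> k%:~R.
Proof.
rewrite neq_ltn => /orP [/ha //|ji] e.
by apply: (ha ji (k := - k)); rewrite rmorphN /= -e opprB.
Qed.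

Definition node n (u : 'I_r.+1 * 'I_n.+1) : K := a u.1 + u.2%:R.

Lemma node_inj n : injective (@node n).
Proof.
move=> [i k] [j l]; rewrite /node /= => e.
have kl : a i - a j = (l%:Z - k%:Z)%:~R.
  by rewrite rmorphB /= -!pmulrn; apply/eqP; rewrite subr_eq addrAC eq_sym
    subr_eq addrC -e addrC.
have ij : i = j by apply/eqP/negPn/negP => ij; exact: (a_not_congruent ij kl).
move: e; rewrite ij => /addrI/eqP; rewrite eqr_nat => /eqP kl'.
by congr (_, _); apply/val_inj.
Qed.

Lemma prod_node_diff n i (k : 'I_n.+1) :
  \prod_(u | u != (i, k)) (node (i, k) - node u)
  = k`!%:R * ((- 1) ^+ (n - k) * (n - k)`!%:R) *
    \prod_(j < r.+1 | j != i) ((a i - a j) * poch (1 + a i - a j) k *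
      ((- 1) ^+ (n - k) * poch (1 + a j - a i) (n - k)%N)).
Proof.
transitivity (\prod_(j < r.+1) \prod_(s < n.+1 | (j, s) != (i, k))
    (node (i, k) - node (j, s))).
  rewrite (pair_big_dep xpredT (fun j s => (j, s) != (i, k))) /=.
  by apply: eq_big => -[j s].
rewrite (bigD1 i) //=; congr (_ * _).
  rewrite -prod_pole_same; apply: eq_big => [s|s _].
    by rewrite xpair_eqE eqxx.
  by rewrite /node /= opprD addrACA subrr add0r.
apply: eq_bigr => j ji.
have -> : 1 + a i - a j = 1 + (a i - a j) by ring.
have -> : 1 + a j - a i = 1 - (a i - a j) by ring.
have kn : (k <= n)%N by rewrite -ltnS.
rewrite -(prod_pole_other (a i - a j) k (n - k)) (subnKC kn) big_mkord.
apply: eq_big => [s|s _]; first by rewrite xpair_eqE (negPf ji).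
by rewrite /node /=; ring.
Qed.

(** The symbols in [b] give the numerator by [poch_product] and those in [a] the
    denominator by [prod_node_diff].  The signs [(-1) ^ l], one for each [b j]
    and one for each column of the grid, cancel the sign of the second
    argument. *)
Lemma term_residue n (q : 'I_p -> nat) i (k : 'I_n.+1) :
  (forall j, m j + n%:Z = (q j)%:Z) ->
  coefc a b m i * (left_coef i k * right_coef i (n - k))
  = (\prod_j \prod_(0 <= s < q j) (node (i, k) - (b j + n%:R - 1 - s%:R)))
    / \prod_(u | u != (i, k)) (node (i, k) - node u).
Proof.
move=> mq; have kn : (k <= n)%N by rewrite -ltnS.
have num j : \prod_(0 <= s < q j) (node (i, k) - (b j + n%:R - 1 - s%:R))
    = (- 1) ^+ (n - k) * (poch (1 + a i - b j) (m j)
      * poch (1 + a i + (m j)%:~R - b j) k * poch (b j - a i) (n - k)%N).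
  have -> : 1 + a i - b j = 1 + (a i - b j) by ring.
  have -> : 1 + a i + (m j)%:~R - b j = 1 + (a i - b j) + (m j)%:~R by ring.
  have -> : b j - a i = - (a i - b j) by ring.
  rewrite (@poch_product _ (a i - b j) (m j) k (n - k) (q j)).
  - rewrite mulrA -exprMn mulrNN mulr1 expr1n mul1r poch_nat.
    apply: eq_bigr => s _; rewrite /node /= natrB //; ring.
  - by rewrite subnKC.
  - move=> mj s sm; apply/eqP => e; apply: (hb mj (i := i) (k := s)).
      by lia.
    by rewrite e.
under eq_bigr do rewrite num.
rewrite prod_node_diff !big_split /= /left_coef /right_coef /hgcoef /coefc.
rewrite (prod_lift i (fun j => poch (1 + a i - a j) k)).
rewrite (prod_lift i (fun j => poch (1 + a j - a i) (n - k)%N)).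
rewrite !prodr_const cardC1 !card_ord /=.
rewrite !invfM invr_sign -exprVn invr_sign -!exprM.
have -> : (- 1) ^+ ((p + r + 1) * (n - k)) =
   (- 1) ^+ ((n - k) * p) * (- 1) ^+ (n - k) * (- 1) ^+ ((n - k) * r) :> K.
  by rewrite -!exprD; congr (_ ^+ _); lia.
by ring.
Qed.

(** The three cases of [sum_residues] for the grid of the [node]s: [deg] is its
    number of points and [M + p * n] the degree of the numerator. *)
Lemma sumH_coefE n :
  let M := \sum_(i < p) m i in
  let alpha := \sum_(i < r.+1) a i in
  let beta := \sum_(i < p) b i in
  let C := alpha + \sum_(i < p) (m i)%:~R * ((m i)%:~R + 1 - 2 * b i) / 2 in
  let deg : int := (r.+1 * n.+1)%N in
  (forall j, 0 <= m j + n%:Z) -> M + (p * n)%N%:Z <= deg ->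
  sumH_coef n =
    if M + (p * n)%N%:Z == deg then
      C + n%:R * (alpha - beta)
        + (p%:R * n%:R * (1 - n%:R) + r.+1%:R * n%:R * (n%:R + 1)) / 2
    else (M + (p * n)%N%:Z + 1 == deg)%:R.
Proof.
move=> M alpha beta C deg mn.
pose q j := absz (m j + n%:Z).
have mq j : m j + n%:Z = q j by rewrite gez0_abs.
have mqK j : (q j)%:R = (m j)%:~R + n%:R :> K.
  by rewrite !pmulrn -mq rmorphD.
pose s := [seq b j + n%:R - 1 - t%:R | j <- enum 'I_p, t <- index_iota 0 (q j)].
have szs : (size s)%:Z = M + (p * n)%N%:Z.
  rewrite size_allpairs_dep sumnE big_map big_enum /=.
  under eq_bigr do rewrite size_iota subn0.
  rewrite (big_morph Posz PoszD (erefl _)).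
  under eq_bigr do rewrite -mq.
  by rewrite big_split /= sumr_const card_ord -mulr_natr natz mulnC -PoszM.
have cardI : #|{: 'I_r.+1 * 'I_n.+1}| = (r.+1 * n.+1)%N.
  by rewrite card_prod !card_ord.
have -> : ((M + (p * n)%N%:Z + 1 == deg) = ((size s).+1 == r.+1 * n.+1)%N).
  by rewrite -szs /deg; lia.
rewrite -szs lez_nat eqz_nat -cardI => sI.
have -> : sumH_coef n = \sum_u (\prod_(t <- s) (node u - t))
    / \prod_(v | v != u) (node u - node (n := n) v).
  rewrite /sumH_coef; under eq_bigr do rewrite mulr_sumr.
  rewrite pair_big /=; apply: eq_bigr => -[i k] _ /=.
  by rewrite (term_residue (q := q)) // big_allpairs_dep big_enum.
rewrite sum_residues //; last exact: node_inj.
case: eqP => [/eqP es|_]; last first.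
  by congr (nat_of_bool _)%:R; have : (0 < r.+1 * n.+1)%N by [];
    rewrite cardI; move: (r.+1 * n.+1)%N (size s) => d u; lia.
have -> : \sum_(t <- s) t = \sum_j ((m j)%:~R + n%:R)
    * (b j + n%:R - 1 - ((m j)%:~R + n%:R - 1) / 2).
  rewrite big_allpairs_dep big_enum; apply: eq_bigr => j _.
  rewrite big_split /= sumrN sum_nat_half sumr_const_nat subn0 -[_ *+ q j]mulr_natl mqK.
  by field.
have -> : \sum_u node (n := n) u
    = n.+1%:R * alpha + r.+1%:R * (n.+1%:R * n%:R / 2).
  rewrite -(pair_big xpredT xpredT (fun i k => node (i, k))) /= /node /=.
  under eq_bigr do rewrite big_split /= sumr_const card_ord -[_ *+ n.+1]mulr_natl.
  rewrite big_split /= -mulr_sumr; congr (_ + _).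
  rewrite sumr_const card_ord -[_ *+ r.+1]mulr_natl; congr (_ * _).
  rewrite -(big_mkord xpredT (fun k : nat => k%:R)) sum_nat_half -[X in _ * (X - 1)]natr1.
  by field.
have -> : C + n%:R * (alpha - beta)
        + (p%:R * n%:R * (1 - n%:R) + r.+1%:R * n%:R * (n%:R + 1)) / 2
   = n.+1%:R * alpha + r.+1%:R * (n.+1%:R * n%:R / 2)
     + (\sum_(i < p) (m i)%:~R * ((m i)%:~R + 1 - 2 * b i) / 2
       - n%:R * beta + p%:R * (n%:R * (1 - n%:R) / 2)).
  by rewrite /C -[n.+1%:R]natr1; field.
congr (_ + _).
have -> : p%:R * (n%:R * (1 - n%:R) / 2) = \sum_(i < p) (n%:R * (1 - n%:R) / 2) :> K.
  by rewrite sumr_const card_ord mulr_natl.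
rewrite mulr_sumr -!sumrN -!big_split /=; apply: eq_bigr => j _.
by field.
Qed.

End Coefficients.

(** * Geometrically dominated series of complex numbers *)

(** The two facts about the field that power series use: the powers of [1 / 2]
    tend to [0], which makes the field archimedean, and a series dominated by
    them converges, which is completeness along such series. *)
Definition geometrically_complete (K : numFieldType) :=
  forall (u : nat -> K) (A : K), (forall n, `|u n| <= A / 2 ^+ n) ->
    u @ \oo --> 0 /\ cvgn (series u).

Lemma cvgn_dist (K : numFieldType) (v : nat -> K) (l : K) :
  (forall e, 0 < e -> \forall n \near \oo, `|l - v n| < e) -> cvgn v.
Proof. by move=> vl; apply/cvg_ex; exists l; apply/cvgrPdist_lt. Qed.

Section ComplexSequences.
Local Open Scope complex_scope.
Variable R : realType.
Implicit Types (u : nat -> R[i]) (A z : R[i]).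

Lemma pos_is_realC A : 0 < A -> exists2 t : R, 0 < t & A = t%:C.
Proof.
move=> A0; have /complex_realP [t e] := gtr0_real A0.
by exists t; rewrite // -ltcR -e.
Qed.

Lemma dominated_realC u A : (forall n, `|u n| <= A / 2 ^+ n) ->
  exists2 t : R, 0 <= t & forall n, `|u n| <= (t / 2 ^+ n)%:C.
Proof.
move=> uA; have A0 : 0 <= A.
  by apply: le_trans (normr_ge0 (u 0%N)) _; rewrite (le_trans (uA _)) // divr1.
have /complex_realP [t e] := ger0_real A0.
exists t; first by rewrite -ler0c -e.
by move=> n; rewrite rmorphM fmorphV rmorphXn rmorph_nat /= -e.
Qed.

Lemma cvg_half (t : R) : (fun n => t / 2 ^+ n) @ \oo --> 0.
Proof.
have := @cvg_geometric _ t (2^-1 : R); rewrite gtr0_norm ?invr_gt0 //.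
rewrite invf_lt1 // ltr1n => /(_ isT); apply: cvg_trans.
by apply: near_eq_cvg; near=> n; rewrite /geometric /= exprVn.
Unshelve. all: by end_near.
Qed.

Lemma cvg_series_dominated_real (v : nat -> R) (t : R) :
  0 <= t -> (forall n, `|v n| <= t / 2 ^+ n) -> cvgn (series v).
Proof.
move=> t0 vt; apply: normed_cvg.
apply: (@series_le_cvg _ _ (geometric t 2^-1)) => [n|n|n|].
- exact: normr_ge0.
- by rewrite /= mulr_ge0 // exprn_ge0 // invr_ge0.
- by rewrite /= exprVn.
- apply: is_cvg_geometric_series.
  by rewrite gtr0_norm ?invr_gt0 // invf_lt1 // ltr1n.
Qed.

Lemma normr_Re_le z : (`|complex.Re z|)%:C <= `|z|.
Proof. by rewrite normc_def lecR -sqrtr_sqr ler_wsqrtr // lerDl sqr_ge0. Qed.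

Lemma normr_Im_le z : (`|complex.Im z|)%:C <= `|z|.
Proof. by rewrite normc_def lecR -sqrtr_sqr ler_wsqrtr // lerDr sqr_ge0. Qed.

Lemma norm_le_ReIm z : `|z| <= (`|complex.Re z| + `|complex.Im z|)%:C.
Proof.
rewrite normc_def lecR -[leRHS]ger0_norm ?addr_ge0 // -sqrtr_sqr ler_wsqrtr //.
by rewrite sqrrD !real_normK ?num_real // addrAC lerDl mulrn_wge0 // mulr_ge0.
Qed.

(** The real and the imaginary parts form real series with the same bound. *)
Lemma complex_geometrically_complete : geometrically_complete R[i].
Proof.
move=> u A /dominated_realC [t t0 ut]; split.
  apply/cvgr0Pnorm_lt => e /pos_is_realC [s s0 ->].
  have /cvgr0Pnorm_lt /(_ s s0) := @cvg_half t.
  apply: filterS => n nt; apply: le_lt_trans (ut n) _.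
  by rewrite ltcR (le_lt_trans _ nt) // ler_norm.
have cRe : cvgn (series (fun n => complex.Re (u n))).
  apply: (cvg_series_dominated_real t0) => n.
  by rewrite -lecR (le_trans (normr_Re_le _)).
have cIm : cvgn (series (fun n => complex.Im (u n))).
  apply: (cvg_series_dominated_real t0) => n.
  by rewrite -lecR (le_trans (normr_Im_le _)).
apply: (@cvgn_dist R[i] _ (Complex (limn (series (fun n => complex.Re (u n))))
  (limn (series (fun n => complex.Im (u n)))))) => e /pos_is_realC [s s0 ->].
have s20 : 0 < s / 2 by rewrite divr_gt0.
move/cvgrPdist_lt/(_ _ s20): cRe; move/cvgrPdist_lt/(_ _ s20): cIm.
apply: filterS2 => n nIm nRe; apply: le_lt_trans (norm_le_ReIm _) _.
rewrite ltcR [s]splitr !raddfB /=.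
rewrite /series /= (raddf_sum (@complex.Re R : Rcomplex R -> R)).
rewrite (raddf_sum (@complex.Im R : Rcomplex R -> R)).
exact: ltrD.
Qed.

End ComplexSequences.

(** * The Cauchy product *)

Section PowerSeries.
Variable K : numFieldType.
Hypothesis Kcomplete : geometrically_complete K.
Implicit Types (u v f g : nat -> K) (A x z : K).

(** The square [k, l < N] of the product of the partial sums, minus the triangle
    [k + l < N] of the partial Cauchy product. *)
Lemma cauchy_product_remainder u v N :
  series u N * series v N
    - series (fun n => \sum_(k < n.+1) u k * v (n - k)%N) N
  = \sum_(0 <= k < N) u k * \sum_(N - k <= l < N) v l.
Proof.
have -> : series (fun n => \sum_(k < n.+1) u k * v (n - k)%N) N
    = \sum_(0 <= k < N) u k * \sum_(0 <= l < N - k) v l.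
  rewrite /series /= !big_mkord.
  under eq_bigr => n _ do rewrite
    (big_ord_widen N (fun k => u k * v (n - k)%N)) //.
  rewrite (exchange_big_dep xpredT) //=; apply: eq_bigr => k _.
  rewrite -mulr_sumr -(big_mkord (fun n => (k < n.+1)%N) (fun n => v (n - k)%N)).
  have kN : (k <= N)%N by exact: ltnW.
  rewrite (@big_cat_nat _ _ _ k) //= big_nat_cond big1 ?add0r; last first.
    by move=> n; lia.
  congr (_ * _); rewrite -{1}[nat_of_ord k]add0n big_addn.
  apply: eq_big => [n|n _]; first by lia.
  by rewrite addnK.
rewrite /series /= mulr_suml -sumrB; apply: eq_big_nat => k /andP[_ kN].
rewrite -mulrBr; congr (_ * _).
by rewrite [X in X - _](@big_cat_nat _ _ _ (N - k)%N) ?leq_subr //= addrAC subrr add0r.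
Qed.

(** Each [k] contributes at most [k] terms of size at most [8 ^- N] to the
    remainder, which is therefore at most [N ^ 2 * 8 ^- N <= 2 ^- N]. *)
Lemma cvg_cauchy_product u v :
  (forall n, `|u n| <= 8 ^- n) -> (forall n, `|v n| <= 8 ^- n) ->
  series (fun n => \sum_(k < n.+1) u k * v (n - k)%N) @ \oo
    --> limn (series u) * limn (series v).
Proof.
move=> u8 v8.
have h8 n : 8 ^- n <= 1 / 2 ^+ n :> K.
  by rewrite div1r lef_pV2 ?posrE ?exprn_gt0 // lerXn2r ?nnegrE // ler_nat.
have cu : cvgn (series u).
  by apply: (Kcomplete (A := 1) _).2 => n; exact: le_trans (u8 n) (h8 n).
have cv : cvgn (series v).
  by apply: (Kcomplete (A := 1) _).2 => n; exact: le_trans (v8 n) (h8 n).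
pose e N := series u N * series v N
  - series (fun n => \sum_(k < n.+1) u k * v (n - k)%N) N.
have e0 : e @ \oo --> 0.
  apply: (Kcomplete (A := 1) _).1 => N; rewrite /e cauchy_product_remainder.
  rewrite (le_trans (ler_norm_sum _ _ _)) //.
  have bound k : (k < N)%N ->
      `|u k * \sum_(N - k <= l < N) v l| <= N%:R * 8 ^- N.
    move=> kN; rewrite normrM.
    apply: (@le_trans _ _ (8 ^- k * \sum_(N - k <= l < N) 8 ^- (N - k))).
      apply: ler_pM => //; rewrite (le_trans (ler_norm_sum _ _ _)) //.
      apply: ler_sum_nat => l /andP[kl _]; apply: le_trans (v8 l) _.
      by rewrite lef_pV2 ?posrE ?exprn_gt0 // ler_weXn2l // ler1n.
    rewrite sumr_const_nat subKn ?(ltnW kN) // -[_ *+ k]mulr_natl mulrCA.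
    rewrite -invfM -exprD subnKC ?(ltnW kN) //.
    by rewrite ler_wpM2r ?invr_ge0 ?exprn_ge0 // ler_nat ltnW.
  apply: (@le_trans _ _ (\sum_(0 <= k < N) N%:R * 8 ^- N)).
    by apply: ler_sum_nat => k /andP[_]; exact: bound.
  rewrite sumr_const_nat subn0 -[_ *+ N]mulr_natl mulrA ler_pdivrMr ?exprn_gt0 //.
  rewrite div1r -natrM -!natrX ler_pdivlMl ?ltr0n ?expn_gt0 //.
  rewrite -natrM ler_nat.
  (* It remains to see that N ^ 2 <= 4 ^ N. *)
  have -> : (8 ^ N = 2 ^ N * (2 ^ N * 2 ^ N))%N by rewrite -!expnMn.
  by rewrite leq_mul2l orbC leq_mul // ltnW // ltn_expl.
have -> : series (fun n => \sum_(k < n.+1) u k * v (n - k)%N)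
    = (fun N => series u N * series v N - e N).
  by apply/funext => N; rewrite /e opprB addrC subrK.
rewrite -[X in _ --> X]subr0; apply: cvgB => //; exact: cvgM.
Qed.

End PowerSeries.

(** * Growth of hypergeometric coefficients *)

Lemma poch_upper (K : numFieldType) (x : K) (k : nat) :
  `|poch x k| <= (`|x| + 1) ^+ k * k`!%:R.
Proof.
elim: k => [|k IHk]; first by rewrite poch0 normr1 fact0 mulr1.
rewrite -addn1 poch_natD normrM addn1 factS mulnC natrM exprSr mulrACA.
apply: ler_pM => //; rewrite poch_nat big_nat1 addr0.
rewrite (le_trans (ler_normD _ _)) // normr_nat -subr_ge0.
have -> : (`|x| + 1) * k.+1%:R - (`|x| + k%:R) = `|x| * k%:R + 1.
  by rewrite -natr1; ring.
by rewrite addr_ge0 ?mulr_ge0.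
Qed.

Section Growth.
Variable K : numFieldType.
Hypothesis Kcomplete : geometrically_complete K.
Implicit Types (x z : K) (f g : nat -> K).

(** Since [`|x| / 2 ^+ n] tends to [0], some [2 ^ n] exceeds [`|x|]. *)
Lemma norm_nat_bound x : exists N, `|x| <= N%:R.
Proof.
pose u n := `|x| / 2 ^+ n.
have uE n : `|u n| = u n by rewrite ger0_norm // divr_ge0 ?exprn_ge0.
have [|/cvgr0Pnorm_lt u0 _] := Kcomplete (u := u) (A := `|x|).
  by move=> n; rewrite uE.
have [N _ /(_ N (leqnn N)) /=] := u0 1 ltr01.
rewrite uE ltr_pdivrMr ?exprn_gt0 // mul1r => /ltW xN.
by exists (2 ^ N)%N; rewrite natrX.
Qed.

(** For [k >= 2 * `|x| + 1] the constant [2] is enough; the sum in the witness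
    takes care of the finitely many smaller [k], each by one of its terms.  A
    sum rather than a maximum, because the order of [K] need not be total. *)
Lemma shift_lower x : (forall k : nat, x + k%:R != 0) ->
  exists2 D, 0 <= D & forall k : nat, k.+1%:R <= D * `|x + k%:R|.
Proof.
move=> x0; have [N xN] := norm_nat_bound (2 * `|x| + 1).
have t0 k : 0 <= k.+1%:R / `|x + k%:R| by rewrite divr_ge0.
exists (2 + \sum_(0 <= k < N) k.+1%:R / `|x + k%:R|).
  by rewrite addr_ge0 // sumr_ge0.
move=> k; rewrite mulrDl; have [kN|Nk] := ltnP k N.
  apply: ler_wpDl; first by rewrite mulr_ge0.
  rewrite -ler_pdivrMr ?normr_gt0 // big_mkord (bigD1 (Ordinal kN)) //=.
  by rewrite lerDl sumr_ge0.
apply: ler_wpDr; first by rewrite mulr_ge0 // sumr_ge0.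
have xk : 2 * `|x| + 1 <= k%:R.
  rewrite (le_trans _ (le_trans xN _)) ?ler_nat //.
  by rewrite [leRHS]ger0_norm ?addr_ge0 ?mulr_ge0.
apply: (@le_trans _ _ (2 * (k%:R - `|x|))); last first.
  rewrite ler_wpM2l //; have := lerB_normD (k%:R : K) x.
  by rewrite normr_nat [k%:R + x]addrC.
rewrite -subr_ge0; have -> : 2 * (k%:R - `|x|) - k.+1%:R = k%:R - (2 * `|x| + 1).
  by rewrite -natr1; ring.
by rewrite subr_ge0.
Qed.

Lemma poch_lower x : (forall k : nat, x + k%:R != 0) ->
  exists2 D, 0 <= D & forall k : nat, k`!%:R <= D ^+ k * `|poch x k|.
Proof.
move=> /shift_lower [D D0 Dx]; exists D => //.
elim=> [|k IHk]; first by rewrite poch0 normr1 fact0 mulr1.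
rewrite -addn1 poch_natD normrM addn1 factS mulnC natrM exprSr mulrACA.
by apply: ler_pM => //; rewrite poch_nat big_nat1 addr0.
Qed.

(** Up to geometric factors, a symbol of index [k] is at most [k!], and at least
    [k!] in the denominator, where no factor vanishes.  So the coefficient is at
    most [k! ^ (p - r - 1)]: this is where [p <= r + 1] enters. *)
Lemma hgcoef_growth p r (b : 'I_p -> K) (a : 'I_r -> K) :
  (p <= r.+1)%N -> (forall j (k : nat), a j + k%:R != 0) ->
  exists2 D, 0 <= D & forall k, `|hgcoef b a k| <= D ^+ k.
Proof.
move=> pr a0.
have /choice [V VE] j : exists D : K,
    0 <= D /\ forall k : nat, k`!%:R <= D ^+ k * `|poch (a j) k|.
  by have [D D0 DE] := poch_lower (a0 j); exists D.
pose U := \prod_(j < p) (`|b j| + 1).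
have U0 : 0 <= U by apply: prodr_ge0 => j _; rewrite addr_ge0.
have V0 : 0 <= \prod_j V j by apply: prodr_ge0 => j _; case: (VE j).
exists (U * \prod_j V j); first exact: mulr_ge0.
move=> k; rewrite /hgcoef !normrM !normfV normr_nat !normr_prod.
have f0 : 0 < k`!%:R :> K by rewrite ltr0n fact_gt0.
have cstE q (x : K) : \prod_(j < q) x = x ^+ q by rewrite prodr_const card_ord.
have bU : \prod_j `|poch (b j) k| <= U ^+ k * k`!%:R ^+ p.
  rewrite /U -prodrXl -(cstE p) -big_split /=.
  by apply: ler_prod => j _; rewrite normr_ge0 poch_upper.
have aV : k`!%:R ^+ r <= (\prod_j V j) ^+ k * \prod_j `|poch (a j) k|.
  rewrite -prodrXl -(cstE r) -big_split /=.
  by apply: ler_prod => j _; rewrite ler0n; case: (VE j) => _ ->.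
have pa0 : 0 < \prod_j `|poch (a j) k|.
  apply: prodr_gt0 => j _; rewrite normr_gt0 poch_nat.
  by rewrite big_mkord; apply/prodf_neq0 => i _; exact: a0.
rewrite ler_pdivrMr // ler_pdivrMr // exprMn.
apply: le_trans bU _; rewrite -!mulrA ler_wpM2l ?exprn_ge0 //.
apply: (@le_trans _ _ (k`!%:R ^+ r * k`!%:R)).
  by rewrite -exprSr ler_weXn2l // ler1n fact_gt0.
by rewrite [leRHS]mulrCA [leLHS]mulrC ler_wpM2l // ler0n.
Qed.

End Growth.

(** * From coefficients to functions near zero *)

Lemma cvg_sum_seq (K : numFieldType) (I : Type) (s : seq I)
    (f : I -> nat -> K) (l : I -> K) :
  (forall i, f i @ \oo --> l i) ->
  (fun n => \sum_(i <- s) f i n) @ \oo --> \sum_(i <- s) l i.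
Proof.
move=> fl; elim: s => [|i s IHs].
  rewrite big_nil; under eq_fun do rewrite big_nil; exact: cvg_cst.
rewrite big_cons; under eq_fun do rewrite big_cons; exact: cvgD.
Qed.

Section Main.
Variable K : numFieldType.
Hypothesis Kcomplete : geometrically_complete K.
Implicit Types (x z : K) (f g e : nat -> K).

Lemma near0_mul_le (D e : K) : 0 <= D -> 0 < e -> \forall z \near (0 : K), D * `|z| <= e.
Proof.
move=> D0 e0; have De : 0 < e / (D + 1) by rewrite divr_gt0 // ltr_wpDl.
apply: filterS (nbhs0_le De) => z; rewrite ler_pdivlMr ?ltr_wpDl // => zD.
by rewrite (le_trans _ zD) // mulrC ler_wpM2l // lerDl.
Qed.

Lemma cvg_power_series_product f g D E :
  0 <= D -> 0 <= E ->
  (forall k, `|f k| <= D ^+ k) -> (forall k, `|g k| <= E ^+ k) ->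
  \forall z \near (0 : K),
    series (fun n => (\sum_(k < n.+1) f k * g (n - k)%N) * z ^+ n) @ \oo
    --> limn (series (fun k => f k * z ^+ k))
        * limn (series (fun k => g k * z ^+ k)).
Proof.
move=> D0 E0 fD gE.
have e8 : 0 < 8^-1 :> K by rewrite invr_gt0.
near=> z.
have Dz : D * `|z| <= 8^-1 by near: z; exact: near0_mul_le.
have Ez : E * `|z| <= 8^-1 by near: z; exact: near0_mul_le.
have small h B k : 0 <= B -> (forall k, `|h k| <= B ^+ k) -> B * `|z| <= 8^-1 ->
    `|h k * z ^+ k| <= 8 ^- k.
  move=> B0 hB Bz; rewrite normrM normrX -exprVn.
  apply: (@le_trans _ _ ((B * `|z|) ^+ k)).
    by rewrite exprMn ler_wpM2r ?exprn_ge0.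
  by rewrite lerXn2r ?nnegrE ?mulr_ge0 // ltW.
have -> : (fun n => (\sum_(k < n.+1) f k * g (n - k)%N) * z ^+ n)
    = (fun n => \sum_(k < n.+1) (f k * z ^+ k) * (g (n - k)%N * z ^+ (n - k))).
  apply/funext => n; rewrite mulr_suml; apply: eq_bigr => k _.
  by rewrite mulrACA -exprD subnKC // -ltnS.
apply: (cvg_cauchy_product Kcomplete (u := fun k => f k * z ^+ k)
  (v := fun k => g k * z ^+ k)) => k;
  [exact: (small f D) | exact: (small g E)].
Unshelve. all: by end_near.
Qed.

Section SumH.
Variables (p r : nat) (a : 'I_r.+1 -> K) (b : 'I_p -> K) (m : 'I_p -> int).
Hypothesis pr : (p <= r.+1)%N.
Hypothesis ha : forall i j : 'I_r.+1, (i < j)%N ->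
  forall k : int, a i - a j <> k%:~R.

(** No lower parameter is a nonpositive integer, so the lower Pochhammer symbols
    never vanish. *)
Lemma lower_params_ok i (j : 'I_r) (k : nat) :
  (1 + a i - a (lift i j) + k%:R != 0) * (1 + a (lift i j) - a i + k%:R != 0).
Proof.
by split; apply/eqP => e;
  [apply: (a_not_congruent ha (i := i) (j := lift i j) (k := - k.+1%:Z))
  |apply: (a_not_congruent ha (j := i) (i := lift i j) (k := - k.+1%:Z))];
  rewrite ?neq_lift // 1?eq_sym ?neq_lift //; rewrite rmorphN /= -pmulrn -natr1;
  apply/eqP; rewrite -addr_eq0 -e; apply/eqP; ring.
Qed.

Lemma cvg_sumH : \forall z \near (0 : K),
  series (fun n => sumH_coef a b m n * z ^+ n) @ \oo --> sumH a b m z.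
Proof.
have each i : \forall z \near (0 : K),
    series (fun n => (\sum_(k < n.+1) left_coef a b m i k
      * right_coef a b i (n - k)%N) * z ^+ n) @ \oo
    --> limn (series (fun k => left_coef a b m i k * z ^+ k))
        * limn (series (fun k => right_coef a b i k * z ^+ k)).
  have [D D0 lD] := hgcoef_growth Kcomplete
    (fun j : 'I_p => 1 + a i + (m j)%:~R - b j) pr
    (fun j k => (lower_params_ok i j k).1).
  have [E E0 rE] := hgcoef_growth Kcomplete
    (fun j : 'I_p => b j - a i) pr (fun j k => (lower_params_ok i j k).2).
  apply: (cvg_power_series_product D0 E0) => // k.
  by rewrite /right_coef normrM !normrX normrN1 !expr1n mul1r.
apply: filterS (filter_forall _ each) => z cz.
have -> : series (fun n => sumH_coef a b m n * z ^+ n) = (fun N =>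
    \sum_(i < r.+1) coefc a b m i * series (fun n => (\sum_(k < n.+1)
      left_coef a b m i k * right_coef a b i (n - k)%N) * z ^+ n) N).
  apply/funext => N; rewrite /series /=.
  under [RHS]eq_bigr do rewrite mulr_sumr.
  rewrite exchange_big /=; apply: eq_bigr => n _.
  by rewrite mulr_suml; apply: eq_bigr => i _; rewrite mulrA.
rewrite /sumH; apply: cvg_sum_seq => i; rewrite -mulrA.
apply: cvgMl_tmp; move: (cz i); rewrite /hypergeom.
suff [-> ->] : (fun k => left_coef a b m i k * z ^+ k) =
    (fun k : nat => (\prod_(j < p) poch (1 + a i + (m j)%:~R - b j) k) /
      (\prod_(j < r) poch (1 + a i - a (lift i j)) k) * (z ^+ k / k`!%:R)) /\
  (fun k => right_coef a b i k * z ^+ k) =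
    (fun k : nat => (\prod_(j < p) poch (b j - a i) k) /
      (\prod_(j < r) poch (1 + a (lift i j) - a i) k)
      * (((-1) ^+ (p + r + 1) * z) ^+ k / k`!%:R)) by [].
split; apply/funext => k; rewrite /left_coef /right_coef /hgcoef.
  by rewrite mulrAC mulrA.
by rewrite exprMn; ring.
Qed.

(** The polynomial is the difference of the two series below [n0].  It vanishes
    for [n0 = 0], so that the case of nonnegative [m] is not separate. *)
Lemma sumH_eq_modulo n0 e (F : K -> K) :
  (forall n, (n0 <= n)%N -> sumH_coef a b m n = e n) ->
  (\forall z \near (0 : K), series (fun n => e n * z ^+ n) @ \oo --> F z) ->
  exists2 q : {poly K}, (size q <= n0)%N &
    \forall z \near (0 : K), sumH a b m z - F z = q.[z].
Proof.
move=> he eF; exists (\poly_(n < n0) (sumH_coef a b m n - e n)).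
  exact: size_poly.
apply: filterS2 cvg_sumH eF => z cH cF.
apply: (cvg_unique _ (cvgB cH cF)); first exact: norm_hausdorff.
apply: cvg_near_cst; exists n0 => // N /= n0N.
rewrite horner_poly fctE /series /= -sumrB (@big_cat_nat _ _ _ n0) //=.
rewrite [X in _ + X]big_nat [X in _ + X]big1 => [|n /andP[n0n _]]; last first.
  by rewrite he // subrr.
by rewrite addr0 big_mkord; apply: eq_bigr => n _; rewrite mulrBl.
Qed.

End SumH.

Lemma near_series_finite N e :
  (forall n, (N <= n)%N -> e n = 0) ->
  \forall z \near (0 : K),
    series (fun n => e n * z ^+ n) @ \oo --> \sum_(n < N) e n * z ^+ n.
Proof.
move=> e0; near=> z; apply: cvg_near_cst; exists N => // n /= Nn.
rewrite /series /= (@big_cat_nat _ _ _ N) //= big_mkord.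
rewrite [X in _ + X]big_nat [X in _ + X]big1 ?addr0 // => k /andP[Nk _].
by rewrite e0 // mul0r.
Unshelve. all: by end_near.
Qed.

Lemma near0_le_half : \forall z \near (0 : K), `|z| <= 2^-1.
Proof. by apply: nbhs0_le; rewrite invr_gt0. Qed.

Lemma cvg_geometric_near : \forall z \near (0 : K),
  series (fun n => (z : K) ^+ n) @ \oo --> ((1 - z)^-1 : K).
Proof.
apply: filterS near0_le_half => z z1.
have zn1 : z != 1.
  by apply: contraTneq z1 => ->; rewrite normr1 invf_ge1 // lern1.
have -> : (fun n => z ^+ n) = geometric 1 z.
  by apply/funext => n; rewrite /= mul1r.
rewrite geometric_seriesE //.
have -> : [sequence 1 * (1 - z ^+ n) / (1 - z)]_n
    = (fun n => (1 - z ^+ n) * (1 - z)^-1).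
  by apply/funext => n /=; rewrite mul1r.
rewrite -[X in _ --> X]mul1r; apply: cvgMr_tmp.
rewrite -[X in _ --> X]subr0; apply: cvgB; first exact: cvg_cst.
apply: (Kcomplete (A := 1) _).1 => n.
by rewrite normrX div1r -exprVn lerXn2r ?nnegrE ?invr_ge0.
Qed.

(** The series of the [(n + 1) * z ^ n] is the Cauchy square of the geometric
    series. *)
Lemma cvg_geometric_derivative_near : \forall z \near (0 : K),
  series (fun n => n%:R * (z : K) ^+ n) @ \oo --> (z / (1 - z) ^+ 2 : K).
Proof.
have one_le k : `|1 : K| <= 1 ^+ k by rewrite normr1 expr1n.
have sq := cvg_power_series_product ler01 ler01 one_le one_le.
near=> z.
have cg : series (fun n => z ^+ n) @ \oo --> (1 - z)^-1.
  by near: z; exact: cvg_geometric_near.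
have zn1 : 1 - z != 0.
  have : `|z| <= 2^-1 by near: z; exact: near0_le_half.
  apply: contraTneq => /eqP; rewrite subr_eq0 => /eqP <-.
  by rewrite normr1 invf_ge1 // lern1.
have : series (fun n => (\sum_(k < n.+1) 1 * 1) * z ^+ n) @ \oo
    --> limn (series (fun k => 1 * z ^+ k)) * limn (series (fun k => 1 * z ^+ k)).
  by near: z; exact: sq.
have -> : (fun k => 1 * z ^+ k) = (fun k => z ^+ k).
  by apply/funext => k; rewrite mul1r.
rewrite (cvg_lim (@norm_hausdorff _ _) cg) => cs.
have -> : z / (1 - z) ^+ 2 = (1 - z)^-1 * (1 - z)^-1 - (1 - z)^-1 by field.
have -> : series (fun n => n%:R * z ^+ n) = (fun N =>
    series (fun n => (\sum_(k < n.+1) 1 * 1) * z ^+ n) N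
    - series (fun n => z ^+ n) N).
  apply/funext => N; rewrite /series /= -sumrB; apply: eq_bigr => n _.
  by rewrite sumr_const card_ord mulr1 -natr1; ring.
exact: cvgB.
Unshelve. all: by end_near.
Qed.

End Main.

(** * The cases of the theorem *)

(** Equality near zero up to a polynomial of degree less than [n].  The strict
    bound is what the proof yields, and for [n = 0] it is plain equality near
    zero. *)
Definition eq_near0_lt (K : numFieldType) (n : nat) (F G : K -> K) : Prop :=
  exists2 q : {poly K}, (size q <= n)%N &
    \forall z \near (0 : K), F z - G z = q.[z].

Section Claims.
Variable K : numFieldType.
Hypothesis Kcomplete : geometrically_complete K.
Variables (p r : nat) (a : 'I_r.+1 -> K) (b : 'I_p -> K) (m : 'I_p -> int).
Hypothesis pr : (p <= r.+1)%N.
Hypothesis ha : forall i j : 'I_r.+1, (i < j)%N ->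
  forall k : int, a i - a j <> k%:~R.
Hypothesis hb : forall j : 'I_p, m j < 0 -> forall (i : 'I_r.+1) (k : int),
  0 <= k <= - m j - 1 -> a i - b j <> k%:~R.
Variable n0 : nat.
Hypothesis mn0 : forall j, 0 <= m j + n0%:Z.

Let M : int := \sum_(i < p) m i.
Let alpha := \sum_(i < r.+1) a i.
Let beta := \sum_(i < p) b i.
Let C := alpha + \sum_(i < p) (m i)%:~R * ((m i)%:~R + 1 - 2 * b i) / 2.
Let H := sumH a b m.

Let mn n j : (n0 <= n)%N -> 0 <= m j + n%:Z.
Proof. by have := mn0 j; lia. Qed.

Lemma sumH_subcritical : M < r%:Z -> eq_near0_lt n0 H (fun _ => 0).
Proof.
move=> Mr; apply: (sumH_eq_modulo Kcomplete pr ha (e := fun=> 0)) => [n n0n|].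
  have pn : (p * n <= r.+1 * n)%N by rewrite leq_mul2r pr orbT.
  have dE : (r.+1 * n.+1 = r.+1 * n + r.+1)%N by rewrite mulnS addnC.
  rewrite (sumH_coefE ha hb) => [|j|]; [|exact: mn|].
    rewrite dE -/M (_ : _ == _ = false); last by lia.
    by rewrite (_ : _ == _ = false) //; lia.
  by rewrite dE -/M; lia.
apply: filterS (near_series_finite (N := 0) (e := fun=> 0 : K) _) => // z.
by rewrite big_ord0.
Qed.

Lemma sumH_critical : M = r%:Z -> (p <= r)%N -> eq_near0_lt n0 H (fun _ => 1).
Proof.
move=> Mr ler; apply: (sumH_eq_modulo Kcomplete pr ha
  (e := fun n => (n == 0%N)%:R)) => [n n0n|].
  have pn : (p * n <= r * n)%N by rewrite leq_mul2r ler orbT.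
  have dE : (r.+1 * n.+1 = r * n + n + r.+1)%N by rewrite mulnS mulSn; lia.
  rewrite (sumH_coefE ha hb) => [|j|]; [|exact: mn|].
    rewrite dE -/M Mr (_ : _ == _ = false); last by lia.
    by congr (nat_of_bool _)%:R; lia.
  by rewrite dE -/M Mr; lia.
apply: filterS (near_series_finite (N := 1) (e := fun n => (n == 0%N)%:R : K) _).
  by move=> z; rewrite big_ord1 mul1r.
by case.
Qed.

Lemma sumH_critical_top :
  M = r%:Z -> p = r.+1 -> eq_near0_lt n0 H (fun z => 1 / (1 - z)).
Proof.
move=> Mr pE; apply: (sumH_eq_modulo Kcomplete pr ha (e := fun=> 1)) => [n n0n|].
  have dE : (r.+1 * n.+1 = p * n + r.+1)%N by rewrite pE mulnS addnC.
  rewrite (sumH_coefE ha hb) => [|j|]; [|exact: mn|].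
    rewrite dE -/M Mr (_ : _ == _ = false); last by lia.
    by rewrite (_ : _ == _ = true) //; lia.
  by rewrite dE -/M Mr; lia.
apply: filterS (cvg_geometric_near Kcomplete) => z.
rewrite div1r; suff -> : (fun n => 1 * z ^+ n) = (fun n => z ^+ n) by [].
by apply/funext => n; rewrite mul1r.
Qed.

Lemma sumH_supercritical :
  M = r.+1%:Z -> (p < r)%N -> eq_near0_lt n0 H (fun _ => C).
Proof.
move=> Mr ltr; apply: (sumH_eq_modulo Kcomplete pr ha
  (e := fun n => (n == 0%N)%:R * C)) => [n n0n|].
  have pn : (p * n + n <= r * n)%N by rewrite addnC -mulSn leq_mul2r ltr orbT.
  have dE : (r.+1 * n.+1 = r * n + n + r.+1)%N by rewrite mulnS mulSn; lia.
  rewrite (sumH_coefE ha hb) => [|j|]; [|exact: mn|].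
    rewrite dE -/M Mr -/alpha -/beta -/C; case: (n =P 0%N) => [->|nn].
      by rewrite ifT ?muln0; [rewrite mulr1n; field | lia].
    rewrite (_ : _ == _ = false) ?mul0r; last by lia.
    by rewrite (_ : _ == _ = false) //; lia.
  by rewrite dE -/M Mr; lia.
apply: filterS (near_series_finite (N := 1) (e := fun n => (n == 0%N)%:R * C) _).
  by move=> z; rewrite big_ord1 mul1r mulr1.
by case=> // n _; rewrite mul0r.
Qed.

Lemma sumH_supercritical_mid :
  M = r.+1%:Z -> p = r -> eq_near0_lt n0 H (fun z => C + z).
Proof.
move=> Mr pE; apply: (sumH_eq_modulo Kcomplete pr ha
  (e := fun n => (n == 0%N)%:R * C + (n == 1%N)%:R)) => [n n0n|].
  have dE : (r.+1 * n.+1 = p * n + n + r.+1)%N by rewrite mulnS mulSn pE; lia.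
  rewrite (sumH_coefE ha hb) => [|j|]; [|exact: mn|].
    rewrite dE -/M Mr -/alpha -/beta -/C; case: (n =P 0%N) => [->|nn].
      by rewrite ifT ?muln0; [rewrite mulr1n mulr0n; field | lia].
    rewrite (_ : _ == _ = false) ?mul0r ?add0r; last by lia.
    by congr (nat_of_bool _)%:R; lia.
  by rewrite dE -/M Mr; lia.
apply: filterS (near_series_finite (N := 2)
  (e := fun n => (n == 0%N)%:R * C + (n == 1%N)%:R) _).
  by move=> z; rewrite big_ord_recr big_ord1 /= !mul0r add0r expr1 mulr1 !mul1r addr0.
by case=> [|[|n]] // _; rewrite mul0r addr0.
Qed.

Lemma sumH_supercritical_top :
  M = r.+1%:Z -> p = r.+1 -> eq_near0_lt n0 H (fun z =>
    (alpha - beta + p%:R) * (z / (1 - z) ^+ 2) + C / (1 - z)).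
Proof.
move=> Mr pE; apply: (sumH_eq_modulo Kcomplete pr ha
  (e := fun n => (alpha - beta + p%:R) * n%:R + C)) => [n n0n|].
  have dE : (r.+1 * n.+1 = p * n + r.+1)%N by rewrite pE mulnS addnC.
  rewrite (sumH_coefE ha hb) => [|j|]; [|exact: mn|].
    rewrite dE -/M Mr ifT; last by lia.
    by rewrite -/alpha -/beta -/C -pE; field.
  by rewrite dE -/M Mr; lia.
apply: filterS2 (cvg_geometric_derivative_near Kcomplete)
  (cvg_geometric_near Kcomplete) => z cd cg.
have -> : series (fun n => ((alpha - beta + p%:R) * n%:R + C) * z ^+ n) =
    (fun N => (alpha - beta + p%:R) * series (fun n => n%:R * z ^+ n) N
       + C * series (fun n => z ^+ n) N).
  apply/funext => N; rewrite /series /= !mulr_sumr -big_split /=.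
  by apply: eq_bigr => n _; ring.
by apply: cvgD; exact: cvgMl_tmp.
Qed.

End Claims.

Lemma eq_near0_of_lt (K : numFieldType) (F G : K -> K) :
  eq_near0_lt 0 F G -> eq_near0 F G.
Proof.
move=> [q]; rewrite leqn0 size_poly_eq0 => /eqP ->; apply: filterS => z.
by rewrite horner0 => /subr0_eq.
Qed.

Lemma eq_near0_mod_of_lt (K : numFieldType) n (F G : K -> K) :
  eq_near0_lt n F G -> eq_near0_mod n F G.
Proof. by move=> [q sq FG]; exists q => //; exact: leqW. Qed.

Theorem theorem1 (R : realType) (p r : nat) (hpr : (p <= r.+1)%N)
    (a : 'I_r.+1 -> R[i]) (b : 'I_p -> R[i]) (m : 'I_p -> int)
    (ha : forall i j : 'I_r.+1, (i < j)%N ->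
       forall k : int, a i - a j <> k%:~R)
    (hb : forall j : 'I_p, m j < 0 -> forall (i : 'I_r.+1) (k : int),
       0 <= k <= - m j - 1 -> a i - b j <> k%:~R) :
  let M : int := \sum_(i < p) m i in
  let H : R[i] -> R[i] := sumH a b m in
  let alpha : R[i] := \sum_(i < r.+1) a i in
  let beta : R[i] := \sum_(i < p) b i in
  let C : R[i] :=
    alpha + \sum_(i < p) (m i)%:~R * ((m i)%:~R + 1 - 2 * b i) / 2 in
  let claims (eqv : (R[i] -> R[i]) -> (R[i] -> R[i]) -> Prop) : Prop :=
    [/\ M < r%:Z -> eqv H (fun _ => 0),
        M = r%:Z ->
          ((p <= r)%N -> eqv H (fun _ => 1)) /\
          (p = r.+1 -> eqv H (fun z => 1 / (1 - z))) &
        M = r.+1%:Z ->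
          [/\ (p < r)%N -> eqv H (fun _ => C),
              p = r -> eqv H (fun z => C + z) &
              p = r.+1 -> eqv H (fun z =>
                (alpha - beta + p%:R) * (z / (1 - z) ^+ 2) + C / (1 - z))]] in
  ((forall i : 'I_p, 0 <= m i) -> claims (@eq_near0 R[i])) /\
  (forall i0 : 'I_p, m i0 < 0 -> (forall i : 'I_p, m i0 <= m i) ->
     claims (@eq_near0_mod R[i] `|m i0|%N)).
Proof.
move=> M H alpha beta C claims.
(* Both parts are the same claims, from an index n0 on with m j + n0 >= 0 for
   all j: n0 is 0 in the first part and the opposite of the least m j in the
   second. *)
have main n0 eqv : (forall j, 0 <= m j + n0%:Z) ->
    (forall F G, eq_near0_lt n0 F G -> eqv F G) -> claims eqv.
  have cpl := @complex_geometrically_complete R.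
  move=> mn0 eqvP; split.
  - by move=> Mr; apply: eqvP; exact: sumH_subcritical.
  - move=> Mr; split=> pE; apply: eqvP.
      exact: sumH_critical.
    exact: sumH_critical_top.
  - move=> Mr; split=> pE; apply: eqvP.
    + exact: sumH_supercritical.
    + exact: sumH_supercritical_mid.
    + exact: sumH_supercritical_top.
split=> [m0 | i0 mi0 mmin].
  apply: (main 0%N) => [j|]; first by rewrite addr0.
  exact: eq_near0_of_lt.
apply: (main (absz (m i0))) => [j|]; first by have := mmin j; lia.
exact: eq_near0_mod_of_lt.
Qed.
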